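(* Let $n\ge 2$. Any finite state automaton accepting the language $L_n$ has at least $2^{n-2}$ states.
   Context: $B_n^+$ is the positive braid monoid, presented as a monoid by generators $\sigma_1,\ldots,\sigma_{n-1}$ and relations $\sigma_i\sigma_j=\sigma_j\sigma_i$ for $|i-j|>1$, $\sigma_i\sigma_j\sigma_i=\sigma_j\sigma_i\sigma_j$ for $|i-j|=1$. Let $\mathcal{A}=\{\sigma_1,\ldots,\sigma_{n-1}\}$ and $\mathcal{A}^*$ the free monoid on $\mathcal{A}$. The relations are homogeneous; for $\beta\in B_n^+$, $\omega(\beta)\in\mathcal{A}^*$ denotes the smallest word representing $\beta$ in the lexicographic order with $\sigma_1<\cdots<\sigma_{n-1}$, and $L_n=\{\omega(\beta)\mid\beta\in B_n^+\}$. A finite state automaton is a quintuple $(\mathfrak{S},\mathcal{A},\mu,Y,S_0)$ with $\mathfrak{S}$ a finite set of states, $\mu:\mathfrak{S}\times\mathcal{A}\to\mathfrak{S}$ the (total) transition function, $Y\subseteq\mathfrak{S}$ the accepted states and $S_0\in\mathfrak{S}$ the initial state; $\mu$ is extended to $\mathfrak{S}\times\mathcal{A}^*\to\mathfrak{S}$ in the natural way, and the accepted language is $\{w\in\mathcal{A}^*\mid\mu(S_0,w)\in Y\}$. *)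

(* Defs.v *)
From HB Require Import structures.
From mathcomp Require Import all_boot all_order all_algebra.
From mathcomp Require Import boolp.

Set Implicit Arguments.
Unset Strict Implicit.
Unset Printing Implicit Defensive.

Import Order.Theory.
Local Open Scope quotient_scope.

(* The letter [i : 'I_n.-1] stands for the generator sigma_(i+1). *)
Notation letter n := 'I_n.-1.
Notation word n := (seq 'I_n.-1).

Inductive braid_relation (n : nat) : word n -> word n -> Prop :=
| braid_comm (i j : letter n) :
    (1 < `|i - j|)%N -> braid_relation [:: i; j] [:: j; i]
| braid_braid (i j : letter n) :
    `|i - j|%N = 1%N -> braid_relation [:: i; j; i] [:: j; i; j].

Inductive braid_cong (n : nat) : word n -> word n -> Prop :=
| cong_rel u v l r :
    braid_relation l r -> braid_cong (u ++ l ++ v) (u ++ r ++ v)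
| cong_refl u : braid_cong u u
| cong_sym u v : braid_cong u v -> braid_cong v u
| cong_trans u v w : braid_cong u v -> braid_cong v w -> braid_cong u w.

Definition braid_congb (n : nat) : rel (word n) :=
  fun u v => `[< braid_cong u v >].

Lemma braid_congb_refl n : reflexive (@braid_congb n).
Proof. by move=> u; apply/asboolP; apply: cong_refl. Qed.

Lemma braid_congb_sym n : symmetric (@braid_congb n).
Proof. by move=> u v; apply/asboolP/asboolP; apply: cong_sym. Qed.

Lemma braid_congb_trans n : transitive (@braid_congb n).
Proof.
by move=> v u w /asboolP uv /asboolP vw; apply/asboolP; apply: cong_trans vw.
Qed.

Canonical braid_equiv n :=
  EquivRel (@braid_congb n) (@braid_congb_refl n) (@braid_congb_sym n)
    (@braid_congb_trans n).

Definition braid (n : nat) := {eq_quot braid_equiv n}.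

HB.instance Definition _ n := EqQuotient.on (braid n).
HB.instance Definition _ n := Choice.on (braid n).

Lemma braid_piP n (u v : word n) :
  \pi_(braid n) u = \pi_(braid n) v <-> braid_cong u v.
Proof. by split=> [/eqmodP/asboolP|uv] //; apply/eqmodP/asboolP. Qed.

Lemma braid_cong_catl n (u v w : word n) :
  braid_cong u v -> braid_cong (w ++ u) (w ++ v).
Proof.
elim=> [a b l r lr|a|a b _|a b c _ ab _]; last 3 first.
- exact: cong_refl.
- exact: cong_sym.
- exact: cong_trans.
by rewrite !(catA w); apply: cong_rel.
Qed.

Lemma braid_cong_catr n (u v w : word n) :
  braid_cong u v -> braid_cong (u ++ w) (v ++ w).
Proof.
elim=> [a b l r lr|a|a b _|a b c _ ab _]; last 3 first.
- exact: cong_refl.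
- exact: cong_sym.
- exact: cong_trans.
by rewrite -!catA; apply: cong_rel.
Qed.

Definition braid_one (n : nat) : braid n := \pi_(braid n) [::].
Definition braid_mul (n : nat) (a b : braid n) : braid n :=
  \pi_(braid n) (repr a ++ repr b).

Lemma braid_mul_pi n (u v : word n) :
  braid_mul (\pi_(braid n) u) (\pi_(braid n) v) = \pi_(braid n) (u ++ v).
Proof.
apply/braid_piP; apply: (@cong_trans _ _ (u ++ repr (\pi_(braid n) v))).
  by apply: braid_cong_catr; apply/braid_piP; rewrite reprK.
by apply: braid_cong_catl; apply/braid_piP; rewrite reprK.
Qed.

Lemma braid_mulA n : associative (@braid_mul n).
Proof.
move=> a b c; rewrite -[a]reprK -[b]reprK -[c]reprK.
rewrite (braid_mul_pi (repr b)) (braid_mul_pi (repr a)).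
by rewrite (braid_mul_pi (repr a)) braid_mul_pi catA.
Qed.

Lemma braid_mul1x n : left_id (braid_one n) (@braid_mul n).
Proof. by move=> a; rewrite -[a]reprK braid_mul_pi. Qed.

Lemma braid_mulx1 n : right_id (braid_one n) (@braid_mul n).
Proof. by move=> a; rewrite -[a]reprK braid_mul_pi cats0. Qed.

HB.instance Definition _ n :=
  isMonoid.Build (braid n) (@braid_mulA n) (@braid_mul1x n) (@braid_mulx1 n).

Definition sigma (n : nat) (i : letter n) : braid n := \pi_(braid n) [:: i].

Definition braid_of_word (n : nat) (w : word n) : braid n :=
  (\prod_(i <- w) sigma i)%g.

Lemma braid_of_wordE n (w : word n) : braid_of_word w = \pi_(braid n) w.
Proof.
rewrite /braid_of_word; elim: w => [|i w IH]; first by rewrite big_nil.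
by rewrite big_cons IH; apply: braid_mul_pi.
Qed.

Lemma braid_of_wordP n (u v : word n) :
  braid_of_word u = braid_of_word v <-> braid_cong u v.
Proof. by rewrite !braid_of_wordE; apply: braid_piP. Qed.

(* [seqlexi] carries the lexicographic order, with sigma_1 < ... < sigma_(n-1)
   as 'I_n.-1 is ordered by value.  Words for the same braid have equal length
   ([braid_cong_size]). *)
Definition least_word (n : nat) (b : braid n) (w : word n) : Prop :=
  braid_of_word w = b /\
  forall v : word n, braid_of_word v = b ->
    ((w : seqlexi 'I_n.-1) <= (v : seqlexi 'I_n.-1))%O.

Lemma braid_cong_size n (u v : word n) : braid_cong u v -> size u = size v.
Proof.
elim=> [a b l r lr|//|//|a b c _ -> //].
by rewrite !size_cat; case: lr.
Qed.

Lemma least_word_exists n (b : braid n) : exists w, least_word b w.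
Proof.
have b0 : braid_of_word (in_tuple (repr b)) == b by rewrite braid_of_wordE reprK.
case: (@arg_minP _ (seqlexi 'I_n.-1) _ (in_tuple (repr b))
  (fun t => braid_of_word t == b) (fun t => tval t) b0) => t /eqP tb tmin.
exists t; split=> // v vb.
have sv : size v == size (repr b).
  apply/eqP/braid_cong_size/braid_of_wordP.
  by rewrite vb; move/eqP: b0.
by apply: (tmin (Tuple sv)); apply/eqP.
Qed.

Lemma least_word_unique n (b : braid n) u v :
  least_word b u -> least_word b v -> u = v.
Proof.
move=> [ub umin] [vb vmin].
by apply: (@le_anti _ (seqlexi 'I_n.-1)); rewrite umin //= vmin.
Qed.

Definition omega (n : nat) (b : braid n) : word n :=
  proj1_sig (cid (least_word_exists b)).

Lemma omegaP n (b : braid n) : least_word b (omega b).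
Proof. exact: proj2_sig (cid (least_word_exists b)). Qed.

Definition braid_language (n : nat) (w : word n) : Prop :=
  exists b : braid n, w = omega b.

Record automaton (A : finType) := Automaton {
  state : finType;
  trans : state -> A -> state;
  accepting : {set state};
  start : state }.

Definition trans_word (A : finType) (M : automaton A) (s : state M)
    (w : seq A) : state M := foldl (@trans A M) s w.

Definition accepted (A : finType) (M : automaton A) (w : seq A) : Prop :=
  trans_word (start M) w \in accepting M.

(* Main.v *)
Require Import Defs.
From mathcomp Require Import all_boot all_order all_algebra.
From mathcomp Require Import zify.

Set Implicit Arguments.
Unset Strict Implicit.
Unset Printing Implicit Defensive.

Import Order.Theory.

(** Write [m = n - 1]. The words [w = s_m^(e_m) ... s_1^(e_1)] with [e_m = 1]
    and all other [e_i] in [{1, 2}] lead to pairwise distinct states, because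
    [w s_(i+1)] is in the language iff [e_i = 2]. If [e_i = 1], commuting the
    last letter leftwards creates [s_(i+1) s_i s_(i+1)], and the braid relation
    gives a smaller word. If [e_i = 2], no projection of [w s_(i+1)] to two
    adjacent generators contains a braid pattern, so these projections are the
    same for all words of the braid; as [w s_(i+1)] goes down by at most one
    index at each step, it is the least word with its projections. *)

(** * Projections to pairs of generators *)

Lemma braid_languageP n (w : word n) :
  braid_language w <->
  forall v, braid_cong w v -> ((w : seqlexi 'I_n.-1) <= (v : seqlexi 'I_n.-1))%O.
Proof.
split=> [[b ->] v|wmin].
  by have [wb wmin] := omegaP b => /braid_of_wordP wv; apply: wmin; rewrite -wv.
exists (braid_of_word w); apply: least_word_unique (omegaP _).
by split=> // v /esym/braid_of_wordP; apply: wmin.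
Qed.

(** Forbidding the pattern in projections, not only among consecutive letters, makes the property
    invariant under commutations. *)
Definition braid_free n (u : word n) : Prop :=
  forall a b : letter n, `|a - b|%N = 1 ->
  forall x y, [seq c <- u | pred2 a b c] <> x ++ [:: a; b; a] ++ y.

(* The case [a = b] matters only for [n = 2], where there are no pairs of
   adjacent generators. *)
Definition same_projections n (u v : word n) : Prop :=
  forall a b : letter n, `|a - b|%N <= 1 ->
  [seq c <- u | pred2 a b c] = [seq c <- v | pred2 a b c].

Lemma same_projections_braid_free n (u v : word n) :
  same_projections u v -> braid_free u -> braid_free v.
Proof. by move=> uv fu a b ab x y; rewrite -uv ?ab //; apply: fu. Qed.

Lemma braid_free_factor n (a b : letter n) (x y : word n) :
  `|a - b|%N = 1 -> ~ braid_free (x ++ [:: a; b; a] ++ y).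
Proof.
move=> ab /(_ a b ab [seq c <- x | pred2 a b c] [seq c <- y | pred2 a b c]).
by rewrite !filter_cat /= !eqxx orbT.
Qed.

(** A commutation swaps two letters that no projection keeps together, and both sides of a braid
    relation contain a forbidden pattern. The disjunction lets the induction pass through
    [cong_sym]. *)
Lemma braid_cong_same_projections n (u v : word n) :
  braid_cong u v -> braid_free u \/ braid_free v -> same_projections u v.
Proof.
elim=> {u v} [u v l r|//|u v _ IH|u v w _ IHuv _ IHvw].
- case=> i j ij.
    move=> _ a b ab; rewrite !filter_cat /=; congr (_ ++ (_ ++ _)).
    have : ~~ (pred2 a b i && pred2 a b j).
      apply/negP => /andP[/pred2P ia /pred2P ja].
      by move: ij; case: ia => ->; case: ja => ->; lia.
    by rewrite /=; case: ((i == a) || _); case: ((j == a) || _).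
  by case=> /braid_free_factor; case; lia.
- by move=> /or_comm/IH uv a b ab; rewrite uv.
case=> [fu|fw] a b ab.
  have uv : same_projections u v by apply: IHuv; left.
  rewrite uv // IHvw //; left; exact: same_projections_braid_free fu.
have vw : same_projections v w by apply: IHvw; right.
rewrite IHuv ?vw //; right; apply: same_projections_braid_free fw => c d cd.
by rewrite vw.
Qed.

(** * Slowly descending words *)

Definition descends_slowly n : rel (letter n) := fun a b => a <= b.+1.

(* A discrete intermediate value property: [u] cannot reach [b] from above
   without passing through [b.+1]. *)
Lemma descends_slowly_head n (a b c : letter n) (u : word n) :
  path (@descends_slowly n) a u -> c = b.+1 :> nat -> c < a -> b \in u ->
  head b [seq d <- u | pred2 b c d] = c.
Proof.
move=> + cb; elim: u a => //= x u IH a /andP[ax xu] ca.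
rewrite /descends_slowly in ax.
case: (x =P c) => [->|xc]; first by rewrite orbT.
have /negPf xb : x != b by apply/eqP => e; move: ax; rewrite e; lia.
rewrite orbF inE eq_sym xb /=; apply: IH xu _.
have : x <> c :> nat by move=> /val_inj.
lia.
Qed.

(** Suppose that at the first difference [v] has [b], smaller than the letter [a] of [u]. The
    projections to [b] and [b.+1] then start differently: in [v] with [b], in [u] with [b.+1], which
    [u] must meet on its way from [a] down to [b]. *)
Lemma descends_slowly_lexi n (u v : word n) :
  sorted (@descends_slowly n) u -> same_projections u v ->
  ((u : seqlexi 'I_n.-1) <= (v : seqlexi 'I_n.-1))%O.
Proof.
elim: u v => [|a u IH] v su uv; first exact: lexi0s.
case: v uv => [|b v] uv.
  by have := uv a a; rewrite /= eqxx /= => /(_ ltac:(lia)).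
rewrite lexi_cons.
have [eab|nab] := eqVneq a b.
  subst b; rewrite lexx /=; apply: IH; first exact: path_sorted su.
  move=> c d cd; have := uv c d cd => /=.
  by case: ifP => // _ [].
suff ab : (a < b)%O by rewrite (ltW ab) leNgt ab.
rewrite ltNge; apply/negP => ba.
have {ba nab} ba : b < a.
  rewrite ltn_neqAle; apply/andP; split; last exact: ba.
  by apply: contra_neq nab => /val_inj.
have [b1a|b1a] := eqVneq b.+1 a.
  have := uv a b; rewrite /= !eqxx orbT /= => /(_ ltac:(lia)) [eab _].
  by move: ba; rewrite eab ltnn.
have hc : b.+1 < n.-1 by have := ltn_ord a; lia.
have bu : b \in u.
  have := uv b b ltac:(lia).
  rewrite /= eqxx orbb; case: eqP => [e|_ /= e]; first by move: ba; rewrite e ltnn.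
  have : b \in [seq c <- u | pred2 b b c] by rewrite e mem_head.
  by rewrite mem_filter => /andP[].
have := @descends_slowly_head n a b (Ordinal hc) u su erefl ltac:(rewrite /=; lia) bu.
have := uv b (Ordinal hc) ltac:(rewrite /=; lia).
rewrite /= eqxx /=.
case: eqP => [e|_]; first by move: ba; rewrite e ltnn.
case: eqP => [e|_]; first by move: b1a; rewrite e eqxx.
by move=> /= -> /= /(congr1 val) /=; lia.
Qed.

Lemma braid_language_braid_free n (u : word n) :
  sorted (@descends_slowly n) u -> braid_free u -> braid_language u.
Proof.
move=> su fu; apply/braid_languageP => v uv.
apply: descends_slowly_lexi su _.
by apply: braid_cong_same_projections uv _; left.
Qed.

(** A nonincreasing word has no pattern, so a pattern would end at the appended [j] and read
    [j i j]; but the projection to [i] and [j] ends in [i i j]. *)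
Lemma braid_free_nonincreasing_rcons n (i j : letter n) (x y : word n) :
  j = i.+1 :> nat -> sorted (fun a b : letter n => b <= a) (x ++ [:: i, i & y]) ->
  all (fun a : letter n => a < i) y -> braid_free (rcons (x ++ [:: i, i & y]) j).
Proof.
move=> ji sw yi a b ab p q; rewrite filter_rcons.
set w := x ++ _ in sw *.
have geq_trans : transitive (fun a b : letter n => b <= a).
  by move=> d c e cd de; apply: leq_trans de cd.
have sfw : sorted (fun a b : letter n => b <= a) [seq c <- w | pred2 a b c].
  exact: sorted_filter.
have nw q' : [seq c <- w | pred2 a b c] <> p ++ [:: a; b; a] ++ q'.
  move=> e; move: sfw; rewrite e; case/cat_sorted2 => _ /= /and3P[]; lia.
case: ifP => [_|_ /nw //].
case/lastP: q => [|q z]; last first.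
  by rewrite -!rcons_cat => /rcons_inj [/nw].
rewrite cats0 -[[:: a; b; a]]/(rcons [:: a; b] a) -rcons_cat.
move=> /rcons_inj [e ja]; subst a.
have ba : b < j.
  move: sfw; rewrite e; case/cat_sorted2 => _ /= /andP[]; lia.
have {ba} bi : b = i by apply: val_inj => /=; lia.
subst b.
have y0 : [seq c <- y | pred2 j i c] = [::].
  apply/eqP; rewrite -[_ == _]negbK -has_filter; apply/hasPn => c /(allP yi) ci.
  by rewrite /= negb_or; apply/andP; split; apply/eqP => e'; subst c; lia.
move: e; rewrite /w filter_cat /= eqxx orbT y0.
rewrite -[[:: i; i]]/(rcons [:: i] i) -[[:: j; i]]/(rcons [:: j] i).
rewrite -!rcons_cat => /rcons_inj [].
rewrite !cats1 => /rcons_inj [_ e]; subst j; lia.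
Qed.

Lemma braid_cong_rcons_commute n (j : letter n) (y : word n) :
  all (fun a : letter n => a.+1 < j) y -> braid_cong (rcons y j) (j :: y).
Proof.
elim: y => [|a y IH] /=; first by move=> _; apply: cong_refl.
move=> /andP[aj /IH yj]; apply: (@cong_trans _ _ [:: a, j & y]).
  exact: (braid_cong_catl [:: a] yj).
by apply: (@cong_rel _ [::] y [:: a; j] [:: j; a]); apply: braid_comm; lia.
Qed.

Lemma not_braid_language_descent n (i j : letter n) (x y : word n) :
  j = i.+1 :> nat -> all (fun a : letter n => a < i) y ->
  ~ braid_language (rcons (x ++ [:: j, i & y]) j).
Proof.
move=> ji yi /braid_languageP /(_ (x ++ [:: i; j; i] ++ y)).
have H : braid_cong (rcons (x ++ [:: j, i & y]) j) (x ++ [:: i; j; i] ++ y).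
  apply: (@cong_trans _ _ (x ++ [:: j; i; j] ++ y)); last first.
    by apply: cong_rel; apply: braid_braid; lia.
  rewrite rcons_cat !rcons_cons; apply/braid_cong_catl/(braid_cong_catl [:: j; i]).
  by apply: braid_cong_rcons_commute; apply: sub_all yi => a; lia.
move=> /(_ H); rewrite rcons_cat /=.
elim: x {H} => [|z x IH] /=; rewrite lexi_cons => /andP[+ +].
  by move=> /= jlei _; have : j <= i by []; lia.
by move=> _; rewrite lexx.
Qed.

(** * Staircase words *)

Section Staircase.

(* Letters are numbered from 0 here, and [f i] says that letter [i] is doubled. *)
Variables (k : nat) (f : nat -> bool).

Fixpoint staircase (m : nat) : word k.+2 :=
  if m is i.+1 then nseq (f i).+1 (inord i) ++ staircase i else [::].

Lemma staircase_lt m : m <= k.+1 -> all (fun a : 'I_k.+1 => a < m) (staircase m).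
Proof.
elim: m => //= m IH mk.
rewrite all_cat all_nseq inordK // ltnSn orbT /=.
by apply: sub_all (IH (ltnW mk)) => a; apply: ltnW.
Qed.

Lemma staircase_nonincreasing m :
  m <= k.+1 -> sorted (fun a b : 'I_k.+1 => b <= a) (staircase m).
Proof.
elim: m => //= m IH mk.
have H : path (fun a b : 'I_k.+1 => b <= a) (inord m) (staircase m).
  rewrite path_min_sorted ?IH 1?ltnW //.
  by apply: sub_all (staircase_lt (ltnW mk)) => a; rewrite inordK //; apply: ltnW.
by case: (f m); rewrite /= ?leqnn.
Qed.

(** A nonempty staircase ends in letter 0, which any [j] may follow because [descends_slowly]
    restricts only descents. *)
Lemma staircase_descends_slowly m j :
  m <= k.+1 -> sorted (@descends_slowly k.+2) (rcons (staircase m) j).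
Proof.
move=> mk.
have H (x : letter k.+2) : x <= m -> path (@descends_slowly k.+2) x (rcons (staircase m) j).
  elim: m mk x => [|m IH] mk x xm /=; first by rewrite /descends_slowly; lia.
  have := IH (ltnW mk) (inord m); rewrite inordK // => /(_ (leqnn m)) Hm.
  by rewrite /descends_slowly; case: (f m); rewrite /= Hm inordK // xm ?leqnSn.
exact: (path_sorted (H ord0 (leq0n m))).
Qed.

Lemma staircase_suffix i m :
  i <= m -> exists x, staircase m = x ++ staircase i.
Proof.
elim: m => [|m IH]; first by case: i => // _; exists [::].
rewrite leq_eqVlt => /orP[/eqP->|/IH[x e]]; first by exists [::].
by exists (nseq (f m).+1 (inord m) ++ x); rewrite -catA -e.
Qed.

Lemma staircase_factor i :
  i < k -> exists x,
  staircase k.+1 = x ++ inord i.+1 :: nseq (f i).+1 (inord i) ++ staircase i.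
Proof.
move=> ik; have [x ->] := @staircase_suffix i.+2 k.+1 ik.
(* The prefix absorbs the extra copy of [inord i.+1] when that letter is doubled. *)
exists (x ++ nseq (f i.+1) (inord i.+1)); rewrite -catA /=.
by case: (f i.+1).
Qed.

Lemma staircase_language i :
  i < k -> braid_language (rcons (staircase k.+1) (inord i.+1)) <-> f i.
Proof.
move=> ik.
have vi : (inord i : 'I_k.+1) = i :> nat by rewrite inordK // ltnW.
have vj : (inord i.+1 : 'I_k.+1) = (inord i : 'I_k.+1).+1 :> nat.
  by rewrite vi inordK.
have lty : all (fun a : 'I_k.+1 => a < (inord i : 'I_k.+1)) (staircase i).
  by rewrite vi; apply: staircase_lt; lia.
have [x e] := staircase_factor ik; split; last first.
  move=> fi; apply: braid_language_braid_free.
    exact: staircase_descends_slowly.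
  have := staircase_nonincreasing (leqnn k.+1).
  rewrite e fi -cat_rcons /= => s.
  exact: (@braid_free_nonincreasing_rcons k.+2 _ _ _ _ vj s lty).
case fi: (f i) => //; rewrite e fi /=.
by move=> /(@not_braid_language_descent k.+2 _ _ _ _ vj lty).
Qed.

End Staircase.

Theorem proposition5p5 (n : nat) (hn : 2 <= n) (M : automaton 'I_n.-1)
    (hM : forall w : seq 'I_n.-1, accepted M w <-> braid_language w) :
  2 ^ (n - 2) <= #|state M|.
Proof.
case: n hn M hM => [|[|k]] // _ M hM; rewrite subSS subSS subn0.
(* [f S] is false at [k], so the top letter is never doubled, and [S] ranges over the [2 ^ k]
   choices for the other letters. *)
pose f (S : {set 'I_k}) i := [exists j in S, val j == i].
have fE (S : {set 'I_k}) (i : 'I_k) : f S i = (i \in S).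
  apply/existsP/idP => [[j /andP[jS /eqP/val_inj <-]]|iS] //.
  by exists i; rewrite iS eqxx.
pose reached S := trans_word (start M) (staircase k (f S) k.+1).
(* Reading letter [i.+1] next tests whether [i] is in [S], so the state [reached S] determines
   [S]. *)
have acc (S : {set 'I_k}) (i : 'I_k) :
    i \in S <-> trans (reached S) (inord i.+1) \in accepting M.
  rewrite -fE -staircase_language // -hM /accepted /trans_word.
  by rewrite foldl_rcons.
have reached_inj : injective reached.
  move=> S T ST; apply/setP => i; apply/idP/idP => /acc; last first.
    by rewrite -ST => /acc.
  by rewrite ST => /acc.
have := leq_card reached reached_inj.
by rewrite -cardsT -powersetT card_powerset cardsT card_ord.
Qed.
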